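(* Let $d\geq 2$. Then there are a constant $\alpha_0=\alpha_0(d)>0$ and a separated net $X$ in $\mathbb{R}^d$ such that $X$ is $\omega$-irregular for any modulus of continuity $\omega$ for which there is $a>0$ with $\omega(t)=t\bigl(\log\frac{1}{t}\bigr)^{\alpha_0}$ for all $t\in(0,a)$.
   Context: A set $A\subseteq\mathbb{R}^d$ is a separated net (of $\mathbb{R}^d$) if there are $r,s>0$ such that $\|x-y\|_2\geq s$ for all distinct $x,y\in A$ and $\operatorname{dist}(z,A)\leq r$ for all $z\in\mathbb{R}^d$. A modulus of continuity is a strictly increasing, concave function $\omega\colon(0,a)\to(0,\infty)$ (for some $a>0$) with $\lim_{t\to0}\omega(t)=0$. Convention: any condition involving a value of $\omega$ is imposed only when the argument lies in the domain of $\omega$ (the condition is void otherwise). Given separated nets $X,Y\subseteq\mathbb{R}^d$ and a modulus of continuity $\omega$, a mapping $f\colon X\to Y$ is a homogeneous $\omega$-mapping if there are constants $K>0$ and $a\in(0,1)$ such that $$\|f(x_2)-f(x_1)\|_2\leq KR\,\omega\left(\frac{\|x_2-x_1\|_2}{R}\right)$$ for all $R>0$ and all (distinct) $x_1,x_2\in X\cap B(\mathbf{0},R)$ with $\|x_2-x_1\|_2<aR$, where $B(\mathbf{0},R)$ is the open Euclidean ball. The net $X$ is $\omega$-regular with respect to $Y$ if there is a bijection $f\colon X\to Y$ such that both $f$ and $f^{-1}$ are homogeneous $\omega$-mappings; otherwise $X$ is $\omega$-irregular with respect to $Y$. When $Y=\mathbb{Z}^d$ one just says $\omega$-regular or $\omega$-irregular.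 *)

(* Defs.v *)
From HB Require Import structures.
From mathcomp Require Import all_boot all_order all_algebra.
From mathcomp Require Import all_classical all_reals all_analysis.

Set Implicit Arguments.
Unset Strict Implicit.
Unset Printing Implicit Defensive.

Import Order.TTheory GRing.Theory Num.Theory.
Import numFieldNormedType.Exports.

Local Open Scope classical_set_scope.
Local Open Scope ring_scope.

(* The norm that the library puts on 'rV[R]_d is the sup norm, not this one. *)
Definition enorm (R : realType) (d : nat) (x : 'rV[R]_d) : R :=
  Num.sqrt (\sum_(i < d) x 0 i ^+ 2).

(* Extended-real valued, so that the distance to the empty set is +oo. *)
Definition edist_set (R : realType) (d : nat) (z : 'rV[R]_d)
    (A : set 'rV[R]_d) : \bar R :=
  ereal_inf [set (enorm (z - x))%:E | x in A].

Definition separated_net (R : realType) (d : nat) (A : set 'rV[R]_d) : Prop :=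
  exists r s : R, [/\ 0 < r, 0 < s,
    forall x y, A x -> A y -> x != y -> s <= enorm (x - y) &
    forall z, (edist_set z A <= r%:E)%E].

Definition integer_lattice (R : realType) (d : nat) : set 'rV[R]_d :=
  [set x | forall i, x 0 i \is a Num.int].

(* A modulus of continuity (0, b) -> (0, +oo) is given by its endpoint b and a
   total function w, whose values outside (0, b) are irrelevant. *)
Definition modulus_of_continuity (R : realType) (b : R) (w : R -> R) : Prop :=
  [/\ 0 < b,
      (forall t : R, 0 < t < b -> 0 < w t),
      {in `]0, b[ &, {homo w : s t / s < t}},
      convex_function (`]0, b[ : set R) (\- w) &
      w t @[t --> 0^'+] --> (0 : R)].

(* The inequality is only required when the argument of w is in (0, b); for
   x1 != x2 and 0 < rho that argument is automatically positive. *)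
Definition homogeneous_mapping (R : realType) (d : nat) (b : R) (w : R -> R)
    (X : set 'rV[R]_d) (f : 'rV[R]_d -> 'rV[R]_d) : Prop :=
  exists K a : R, [/\ 0 < K, 0 < a < 1 &
    forall (rho : R) (x1 x2 : 'rV[R]_d), 0 < rho -> X x1 -> X x2 -> x1 != x2 ->
      enorm x1 < rho -> enorm x2 < rho ->
      enorm (x2 - x1) < a * rho -> enorm (x2 - x1) / rho < b ->
      enorm (f x2 - f x1) <= K * rho * w (enorm (x2 - x1) / rho)].

(* A bijection X -> Y is a total function f with set_bij X Y f; on Y, the
   function g coincides with its inverse Y -> X. *)
Definition regular_wrt (R : realType) (d : nat) (b : R) (w : R -> R)
    (X Y : set 'rV[R]_d) : Prop :=
  exists f g : 'rV[R]_d -> 'rV[R]_d,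
    [/\ set_bij X Y f, {in X, cancel f g},
        homogeneous_mapping b w X f & homogeneous_mapping b w Y g].

Definition irregular_wrt (R : realType) (d : nat) (b : R) (w : R -> R)
    (X Y : set 'rV[R]_d) : Prop := ~ regular_wrt b w X Y.

Definition irregular (R : realType) (d : nat) (b : R) (w : R -> R)
    (X : set 'rV[R]_d) : Prop := irregular_wrt b w X (@integer_lattice R d).

(* Main.v *)
Require Import Defs.
From mathcomp Require Import all_boot all_order all_algebra.
From mathcomp Require Import all_classical all_reals all_analysis.
From mathcomp Require Import zify ring lra.

Set Implicit Arguments.
Unset Strict Implicit.
Unset Printing Implicit Defensive.

Import Order.TTheory GRing.Theory Num.Theory.

Local Open Scope ring_scope.

(** The net X is a subset of Z^d in the spirit of Burago and Kleiner.  Off a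
    sparse hierarchy of tubes, which run in direction i0 and have widths
    growing like 2^(n^2), it has density 1/2; along a tube of width w its
    density alternates between 1 and 1/2 on consecutive cells of side w.
    Suppose that a bijection f of X onto Z^d and its inverse g are L-Lipschitz
    on a large ball.  If f stretches some segment of length w_(j+1) in
    direction i0 almost as much as the best constant for length w_j allows,
    then, by strict convexity of the Euclidean norm, most steps of length w_j
    along a nearby tube are mapped to almost the same vector W.  Then
    y |-> g (f y + W) is an injection moving most points of a cell of density 1
    to within a small distance of their translates in the next cell, of density
    about 1/2, which is impossible.  So the best stretch constant drops by a
    factor 1 - c(d) L^-4 from each scale to the next coarser one; after about
    L^8 scales it would fall below the lower bound 1 / L.  As the radius of the
    ball is exp(O(L^16)), the choice alpha0 = 1/32 makes L large enough at
    every radius. *)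

(** * Scales of the tubes and elementary counting *)

Definition width (n : nat) : nat := 2 ^ ((n + 3) ^ 2).

(** The tubes of level [n] fill a proportion [2 ^ -(n + 6)] of space, and these proportions sum to
    1/32. The exponent [(n + 3) ^ 2] in [width] is such that [width n.+1] consists of [2 ^ n.+1]
    whole periods [gap n]. *)
Definition gap (n : nat) : nat := width n * 2 ^ (n + 6).

Lemma width_gt0 n : (0 < width n)%N.
Proof. by rewrite expn_gt0. Qed.

Lemma width_mono m n : (m <= n)%N -> (width m <= width n)%N.
Proof. by move=> mn; rewrite leq_pexp2l // leq_exp2r // leq_add2r. Qed.

Lemma gap_gt0 n : (0 < gap n)%N.
Proof. by rewrite muln_gt0 width_gt0 expn_gt0. Qed.

Lemma widthS n : width n.+1 = (gap n * 2 ^ n.+1)%N.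
Proof.
rewrite /gap /width -!expnD; congr (2 ^ _)%N.
rewrite -!mulnn; lia.
Qed.

Lemma gap_dvd_width m n : (m < n)%N -> (gap m %| width n)%N.
Proof.
elim: n => // n IHn; rewrite ltnS leq_eqVlt => /predU1P[->|/IHn].
  by rewrite widthS dvdn_mulr.
by move/dvdn_trans; apply; rewrite widthS /gap -mulnA dvdn_mulr.
Qed.

Lemma double_width_leS n : (2 * gap n <= width n.+1)%N.
Proof. by rewrite widthS mulnC leq_mul2l expnS leq_pmulr ?orbT ?expn_gt0. Qed.

Lemma card_ord_modn_le (N a b : nat) : (0 < b)%N -> (b %| N)%N ->
  (#|[set t : 'I_N | (t %% b < a)%N]| * b <= N * a)%N.
Proof.
move=> b0 /dvdnP[q ->].
have -> : #|[set t : 'I_(q * b) | (t %% b < a)%N]|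
    = (\sum_(0 <= t < q * b) (t %% b < a))%N.
  by rewrite -sum1dep_card big_mkcond big_mkord; apply: eq_bigr => i _; case: ifP.
rewrite mulnAC leq_mul2r; apply/orP; right.
elim: q => [|q IHq]; first by rewrite mul0n big_geq.
rewrite mulSn [(b + _)%N]addnC (big_cat_nat (n := (q * b)%N)) ?leq_addr //=.
rewrite mulSn [(a + _)%N]addnC leq_add // -{1}[(q * b)%N]add0n big_addn addKn.
rewrite (eq_big_nat _ _ (F2 := fun t => (t < a)%N : nat)) => [|t /andP[_ tb]].
  have : (\sum_(0 <= t < b) (t < a) <= minn a b)%N; last lia.
  elim: (b) => [|c IHc]; first by rewrite big_geq.
  by rewrite big_nat_recr //=; lia.
by rewrite addnC modnMDl modn_small.
Qed.

Lemma card_ffun_coord (I T : finType) (P : pred T) (i : I) :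
  (#|[set u : {ffun I -> T} | P (u i)]| * #|T| = #|P| * #|{: {ffun I -> T}}|)%N.
Proof.
pose F (j : I) : pred T := if j == i then P else predT.
have -> : #|[set u : {ffun I -> T} | P (u i)]| = #|family F|.
  apply: eq_card => u; rewrite inE; apply/idP/familyP => [Pu j|/(_ i)].
    by rewrite /F; case: eqVneq => // ->.
  by rewrite /F eqxx.
rewrite card_family card_ffun foldrE big_image /=.
rewrite (bigD1 i) //= {1}/F eqxx (eq_bigr (fun=> #|T|)) => [|j /negbTE jNi].
  rewrite prod_nat_const -mulnA -expnSr; congr (_ * _ ^ _)%N.
  by rewrite cardC1 prednK //; apply/card_gt0P; exists i.
by apply: eq_card => t; rewrite /F jNi.
Qed.

(** * The net inside Z^d and its density in cells *)

Section Net.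

Variables (d : nat) (i0 i1 : 'I_d).

(** Only coordinate [i1] is constrained, so for [d > 2] the tubes are slabs. *)
Definition in_tube (n : nat) (x : 'rV[int]_d) : bool :=
  ((x 0%R i1 %% (gap n)%:Z)%Z < (width n)%:Z).

Definition in_finer_tube (n : nat) (x : 'rV[int]_d) : bool :=
  [exists k : 'I_n, in_tube k x].

(* The finest tube containing a point decides whether it is kept. *)
Definition int_net (x : 'rV[int]_d) : Prop :=
  (2 %| x 0%R i0)%Z \/
  exists n, [/\ in_tube n x, ~~ in_finer_tube n x
              & (2 %| (x 0%R i0 %/ (width n)%:Z)%Z)%Z].

Lemma int_netE n x : in_tube n x -> ~~ in_finer_tube n x ->
  int_net x <-> (2 %| x 0%R i0)%Z \/ (2 %| (x 0%R i0 %/ (width n)%:Z)%Z)%Z.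
Proof.
move=> xn xNn; split=> [[|[k [xk xNk]]]|[]]; [by left| |by left|by right; exists n].
have -> : k = n; last by right.
case: (ltngtP k n) => // [kn|nk].
  by move/negP: xNn; case; apply/existsP; exists (Ordinal kn).
by move/negP: xNk; case; apply/existsP; exists (Ordinal nk).
Qed.

(** The functions [u] enumerate the cube [[0, v)^d], so that parts of a cell become finite sets with
    a cardinal. *)
Definition offset (v : nat) (u : {ffun 'I_d -> 'I_v}) : 'rV[int]_d :=
  \row_i (u i : nat)%:Z.

Lemma offsetE v (u : {ffun 'I_d -> 'I_v}) i : offset u 0 i = (u i : nat)%:Z.
Proof. by rewrite mxE. Qed.

(** Level [k] takes at most a proportion [2 ^ -(k + 6)] of the cell, since [gap k] divides both the
    side of the cell and its position in direction [i1]; these proportions are then summed over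
    [k < n]. *)
Lemma card_in_finer_tube n v (p : 'rV[int]_d) :
    ((gap n)%:Z %| p 0%R i1)%Z -> (width n %| v)%N ->
  (#|[set u : {ffun 'I_d -> 'I_v} | in_finer_tube n (p + offset u)]| * 32
    <= #|{: {ffun 'I_d -> 'I_v}}|)%N.
Proof.
move=> pg wv; set C := #|{: {ffun 'I_d -> 'I_v}}|.
pose S k := [set u : {ffun 'I_d -> 'I_v} | in_tube k (p + offset u)].
have cardS k : (k < n)%N -> (#|S k| * 2 ^ (k + 6) <= C)%N.
  move=> kn; have gv : (gap k %| v)%N.
    exact: dvdn_trans (gap_dvd_width kn) wv.
  have -> : S k = [set u : {ffun 'I_d -> 'I_v} | (u i1 %% gap k < width k)%N].
    apply/setP => u; rewrite !inE /in_tube mxE offsetE.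
    have /dvdzP[q ->] : ((gap k)%:Z %| p 0%R i1)%Z.
      apply: dvdz_trans pg; apply/(@dvdn_trans (width n)); first exact: gap_dvd_width.
      by rewrite /gap dvdn_mulr.
    by rewrite modzMDl modz_nat ltz_nat.
  have [->|v0] := posnP v.
    rewrite [X in (X * _)%N](_ : _ = 0)%N //.
    by apply/eqP; rewrite cards_eq0; apply/eqP/setP => u; case: (u i1).
  have := card_ffun_coord (fun t : 'I_v => (t %% gap k < width k)%N) i1.
  rewrite card_ord -/C => eqS.
  have := card_ord_modn_le (width k) (gap_gt0 k) gv; rewrite cardsE => leS.
  rewrite -(leq_pmul2r v0) -(leq_pmul2r (width_gt0 k)) (mulnAC #|_|) eqS.
  rewrite -mulnA [(2 ^ _ * _)%N]mulnC -/(gap k) mulnAC [leqLHS]mulnC -[leqRHS]mulnA.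
  by rewrite leq_mul2l leS orbT.
(* Division-free form of the bound [(1 - 2 ^ -m) / 32] on the proportion taken by the first [m]
   levels; the subtracted term makes the induction work. *)
have sumS m : (m <= n)%N -> ((\sum_(k < m) #|S k|) * 2 ^ (m + 5) + C <= C * 2 ^ m)%N.
  elim: m => [|m IHm mn]; first by rewrite big_ord0 mul0n muln1.
  rewrite big_ord_recr /= mulnDl addSn -[(m + 5).+1]addnS.
  have := cardS _ mn; have := IHm (ltnW mn).
  rewrite !expnD !expnS; set A := (\sum_(_ < _) _)%N; set P := (2 ^ m)%N.
  by rewrite !expn0; clearbody A P C; move: #|S m| => B; clear; nia.
have subS : [set u : {ffun 'I_d -> 'I_v} | in_finer_tube n (p + offset u)]
    \subset \bigcup_(k < n) S k.
  apply/fintype.subsetP => u; rewrite inE => /existsP[k uk].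
  by apply/bigcupP; exists k; rewrite // inE.
have leS : (#|\bigcup_(k < n) S k| <= \sum_(k < n) #|S k|)%N.
  elim/big_rec2: _ => [|k A B _ IH]; first by rewrite cards0.
  by rewrite (leq_trans (leq_card_setU _ _)) // leq_add2l.
have := leq_trans (subset_leq_card subS) leS; have := sumS _ (leqnn n).
rewrite expnD; have : (0 < 2 ^ n)%N by rewrite expn_gt0.
move: (2 ^ n)%N (\sum_(_ < _) _)%N => P A; rewrite (_ : 2 ^ 5 = 32)%N //; nia.
Qed.

Lemma card_even_coord v : (2 %| v)%N ->
  (#|[set u : {ffun 'I_d -> 'I_v} | ~~ odd (u i0)]| * 2
    <= #|{: {ffun 'I_d -> 'I_v}}|)%N.
Proof.
move=> v2; have [->|v0] := posnP v.
  rewrite [X in (X * _)%N](_ : _ = 0)%N //.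
  by apply/eqP; rewrite cards_eq0; apply/eqP/setP => u; case: (u i0).
have := card_ffun_coord (fun t : 'I_v => ~~ odd t) i0; rewrite card_ord => eqS.
have := card_ord_modn_le 1 (isT : 0 < 2)%N v2.
rewrite muln1 (eq_card (B := fun t : 'I_v => ~~ odd t)) => [leS|t]; last first.
  by rewrite !inE modn2 ltnS leqn0 eqb0.
by rewrite -(leq_pmul2r v0) mulnAC eqS mulnAC [leqRHS]mulnC leq_mul2r leS orbT.
Qed.

Lemma card_near_boundary v r :
  (#|[set u : {ffun 'I_d -> 'I_v} |
      [exists i, (u i < r)%N || (v <= u i + r)%N]]| * v
    <= d * (2 * r) * #|{: {ffun 'I_d -> 'I_v}}|)%N.
Proof.
set C := #|{: _}|.
pose P (t : 'I_v) := (t < r)%N || (v <= t + r)%N.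
pose S i := [set u : {ffun 'I_d -> 'I_v} | P (u i)].
have cardP : (#|P| <= 2 * r)%N.
  (* Folds the two margins of width [r] into [[0, 2 r)]: the lower one stays in place, the upper one
     is reflected behind it. *)
  pose h (t : 'I_v) : nat := if (t < r)%N then t : nat else (v.-1 - t + r)%N.
  have hlt t : P t -> (h t < 2 * r)%N.
    by rewrite /P /h; have := ltn_ord t; case: (ltnP t r) => /=; lia.
  have hinj : {in P &, injective h}.
    move=> s t; rewrite !unfold_in /P /h => Ps Pt hst; apply: val_inj => /=.
    have := ltn_ord s; have := ltn_ord t.
    by move: Ps Pt hst; case: (ltnP s r); case: (ltnP t r) => /=; lia.
  rewrite cardE -(size_map h) -[leqRHS](size_iota 0).
  apply: uniq_leq_size.
    rewrite map_inj_in_uniq ?enum_uniq // => s t; rewrite !mem_enum; exact: hinj.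
  by move=> _ /mapP[t + ->]; rewrite mem_enum mem_iota; exact: hlt.
have subS : [set u : {ffun 'I_d -> 'I_v} |
      [exists i, (u i < r)%N || (v <= u i + r)%N]] \subset \bigcup_i S i.
  apply/fintype.subsetP => u; rewrite inE => /existsP[i ui].
  by apply/bigcupP; exists i; rewrite // inE.
have leS : (#|\bigcup_i S i| <= \sum_i #|S i|)%N.
  elim/big_rec2: _ => [|k A B _ IH]; first by rewrite cards0.
  by rewrite (leq_trans (leq_card_setU _ _)) // leq_add2l.
have : ((\sum_i #|S i|) * v <= d * (2 * r) * C)%N.
  rewrite big_distrl /= -mulnA -[X in (_ <= X * _)%N]card_ord -sum_nat_const.
  apply: leq_sum => i _; have := card_ffun_coord P i; rewrite card_ord -/C => ->.
  by rewrite leq_mul2r cardP orbT.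
apply: leq_trans; rewrite leq_mul2r (leq_trans (subset_leq_card subS) leS) orbT //.
Qed.

End Net.

(** * Sup distance on Z^d and almost translations between consecutive cells *)

Definition close (d : nat) (r : int) (x y : 'rV[int]_d) : Prop :=
  forall i, `|x 0 i - y 0 i| <= r.

Lemma closeC d r (x y : 'rV[int]_d) : close r x y -> close r y x.
Proof. by move=> xy i; rewrite distrC. Qed.

Lemma close_trans d r s (x y z : 'rV[int]_d) :
  close r x y -> close s y z -> close (r + s) x z.
Proof. by move=> xy yz i; have := xy i; have := yz i; lia. Qed.

Lemma close_le d r s (x y : 'rV[int]_d) : r <= s -> close r x y -> close s x y.
Proof. by move=> rs xy i; exact: le_trans rs. Qed.

Section Translation.

Variables (d : nat) (i0 i1 : 'I_d).
Hypothesis i01 : i0 != i1.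

Definition axis (c : int) : 'rV[int]_d := \row_i (if i == i0 then c else 0).

Lemma axisE c i : axis c 0 i = if i == i0 then c else 0.
Proof. by rewrite mxE. Qed.

Lemma axisD a b : axis (a + b) = axis a + axis b.
Proof. by apply/rowP => i; rewrite !mxE; case: eqP. Qed.

(* The cell at [p] is full and the next one half full, up to finer tubes, so an
   almost translation cannot inject the first into the second. *)
Lemma no_uniform_translation n r (p : 'rV[int]_d)
    (bad : {set {ffun 'I_d -> 'I_(width n)}})
    (phi : {ffun 'I_d -> 'I_(width n)} -> 'rV[int]_d) :
    ((2 * width n)%:Z %| p 0%R i0)%Z -> ((gap n)%:Z %| p 0%R i1)%Z ->
    (32 * d * r <= width n)%N ->
    (16 * #|bad| <= #|{: {ffun 'I_d -> 'I_(width n)}}|)%N ->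
    (forall u, u \notin bad -> int_net i0 i1 (p + offset u) ->
      int_net i0 i1 (phi u) /\
      close r%:Z (phi u) (p + offset u + axis (width n)%:Z)) ->
    (forall u t, u \notin bad -> t \notin bad ->
      int_net i0 i1 (p + offset u) -> int_net i0 i1 (p + offset t) ->
      phi u = phi t -> u = t) ->
  False.
Proof.
move=> p0 p1 rv cbad hphi phi_inj; set v := width n in bad phi rv cbad hphi phi_inj p0 *.
have v0 : (0 < v)%N := width_gt0 n.
set q := p + axis v%:Z.
set C := #|{: {ffun 'I_d -> 'I_v}}| in cbad.
have C0 : (0 < C)%N by apply/card_gt0P; exists [ffun=> Ordinal v0].
set fine := fun p : 'rV[int]_d =>
  [set u : {ffun 'I_d -> 'I_v} | in_finer_tube i1 n (p + offset u)].
set edge := [set u : {ffun 'I_d -> 'I_v} |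
      [exists i, (u i < r)%N || (v <= u i + r)%N]].
set ev := [set u : {ffun 'I_d -> 'I_v} | ~~ odd (u i0)].
have q1 : q 0 i1 = p 0 i1 by rewrite !mxE eq_sym (negbTE i01) addr0.
have v2 : (2 %| v)%N by rewrite /v /width dvdn_exp // addnS expn_gt0.
have tubeP (x : 'rV[int]_d) (u : {ffun 'I_d -> 'I_v}) :
    ((gap n)%:Z %| x 0%R i1)%Z -> in_tube i1 n (x + offset u).
  move=> /dvdzP[c xc]; rewrite /in_tube mxE offsetE xc modzMDl modz_nat ltz_nat.
  by rewrite (leq_ltn_trans (leq_mod _ _)).
have [c pc] := dvdzP p0.
have vZ : v%:Z != 0 by rewrite eqz_nat -lt0n.
have udiv (u : {ffun 'I_d -> 'I_v}) : ((u i0 : nat)%:Z %/ v%:Z)%Z = 0.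
  by rewrite divz_small // lez_nat ltz_nat /= ltn_ord.
(* The quotient of coordinate [i0] by [v] is even throughout the cell at [p] and odd throughout the
   cell at [q]. Off the finer tubes the first cell is therefore full, and the second keeps only even
   coordinates [i0], as [v] is even. *)
have net_p u : u \notin fine p -> int_net i0 i1 (p + offset u).
  rewrite inE => uf; apply/(int_netE i0 (tubeP _ _ p1) uf); right.
  by rewrite mxE offsetE pc PoszM mulrA divzMDl // udiv addr0 dvdz_mull.
have net_q u : int_net i0 i1 (q + offset u) -> u \in ev :|: fine q.
  move=> qu; rewrite inE orbC; case: (boolP (u \in fine q)) => //=.
  rewrite inE => uf; rewrite -q1 in p1.
  move/(int_netE i0 (tubeP _ _ p1) uf): qu; rewrite mxE [q 0 i0]mxE axisE eqxx.
  rewrite offsetE pc inE => -[|]; first by lia.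
  rewrite PoszM mulrA -[X in _ + X + _]mul1r -mulrDl divzMDl // udiv.
  by lia.
(* The position of [phi u] in the cell at [q]. The default value [u i] never occurs on [S], whose
   points stay away from the faces of the cell by [r]. *)
pose psi (u : {ffun 'I_d -> 'I_v}) : {ffun 'I_d -> 'I_v} :=
  [ffun i => insubd (u i) `|phi u 0%R i - q 0%R i|%N].
pose S := ~: (bad :|: fine p :|: edge).
have SP u : u \in S -> [/\ u \notin bad, int_net i0 i1 (p + offset u) &
     phi u = q + offset (psi u)].
  rewrite !inE !negb_or -andbA => /and3P[ub uf ue].
  have up : int_net i0 i1 (p + offset u) by apply: net_p; rewrite inE.
  split=> //; have [_ uphi] := hphi u ub up.
  apply/rowP => i; rewrite [RHS]mxE offsetE ffunE val_insubd.
  have := uphi i; rewrite (addrAC p) -/q [(q + _) 0 i]mxE offsetE.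
  move/existsPn: ue => /(_ i); rewrite negb_or -!ltnNge.
  set a := q 0 i; set b := phi u 0 i; move=> /andP[h1 h2] h3.
  have ab : (`|b - a| < v)%N by lia.
  by rewrite ab; lia.
have psi_inj : {in S &, injective psi}.
  move=> u t uS tS ut; have [ub up pu] := SP u uS; have [tb tp pt] := SP t tS.
  by apply: phi_inj => //; rewrite pu pt ut.
have leST : (#|S| <= #|ev :|: fine q|)%N.
  rewrite -(card_in_imset psi_inj); apply: subset_leq_card.
  apply/fintype.subsetP => _ /imsetP[u uS ->]; have [ub up pu] := SP u uS.
  by apply: net_q; rewrite -pu; have [] := hphi u ub up.
have cS : (C <= #|S| + #|bad| + #|fine p| + #|edge|)%N.
  rewrite /C -[X in (X <= _)%N](cardsC S) finset.setCK -!addnA leq_add2l addnA.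
  by rewrite (leq_trans (leq_card_setU _ _)) // leq_add2r leq_card_setU.
have cT : (#|ev :|: fine q| <= #|ev| + #|fine q|)%N by rewrite leq_card_setU.
have c1 : (#|fine p| * 32 <= C)%N := card_in_finer_tube p1 (dvdnn v).
have c2 : (#|fine q| * 32 <= C)%N by apply: card_in_finer_tube (dvdnn v); rewrite q1.
have c3 : (#|ev| * 2 <= C)%N by exact: card_even_coord.
have c4 : (#|edge| * 16 <= C)%N.
  have := card_near_boundary d v r; rewrite -/edge -/C => h.
  by rewrite -(leq_pmul2r v0); nia.
(* The proportions give [C <= (1/2 + 2/32 + 2/16) C = 11/16 C], contradicting [C > 0]. *)
clear -C0 leST cS cT c1 c2 c3 c4 cbad.
move: #|S| #|bad| #|fine p| #|edge| #|ev| #|fine q| #|_| leST cS cT c1 c2 c3 c4 cbad.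
by lia.
Qed.

End Translation.

(** * Squared norms of integer vectors and averaging *)

Section Energy.

Variable d : nat.
Implicit Types x y F : 'rV[int]_d.

Definition dot x y : int := \sum_i x 0 i * y 0 i.

Definition sqn x : int := dot x x.

Lemma sqn_ge0 x : 0 <= sqn x.
Proof. by apply: sumr_ge0 => i _; rewrite -expr2 sqr_ge0. Qed.

Lemma sqn_ge_coord x i : x 0 i ^+ 2 <= sqn x.
Proof.
rewrite /sqn /dot (bigD1 i) //= expr2 lerDl.
by apply: sumr_ge0 => j _; rewrite -expr2 sqr_ge0.
Qed.

Lemma dot_suml (I : Type) (r : seq I) (v : I -> 'rV[int]_d) y :
  dot (\sum_(k <- r) v k) y = \sum_(k <- r) dot (v k) y.
Proof.
rewrite /dot exchange_big; apply: eq_bigr => i _.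
by rewrite summxE mulr_suml.
Qed.

Lemma dot_le x y (a b : int) :
  (forall i, `|x 0 i| <= a) -> (forall i, `|y 0 i| <= b) ->
  `|dot x y| <= d%:Z * (a * b).
Proof.
move=> xa yb; apply: (le_trans (ler_norm_sum _ _ _)).
apply: (@le_trans _ _ (\sum_(i < d) a * b)).
  by apply: ler_sum => i _; rewrite normrM ler_pM.
by rewrite sumr_const card_ord -mulr_natl natz.
Qed.

Lemma sqn_le x (a : int) : (forall i, `|x 0 i| <= a) -> sqn x <= d%:Z * a ^+ 2.
Proof. by move=> xa; rewrite expr2 (le_trans (ler_norm _)) ?dot_le. Qed.

Lemma sum_sqn_scale_sub (N : nat) (c : int) (v : nat -> 'rV[int]_d) F :
  \sum_(k < N) sqn (c *: v k - F) =
  c ^+ 2 * (\sum_(k < N) sqn (v k)) - 2 * c * dot (\sum_(k < N) v k) F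
    + N%:Z * sqn F.
Proof.
have -> : N%:Z * sqn F = \sum_(k < N) sqn F.
  by rewrite sumr_const card_ord -mulr_natl natz.
rewrite dot_suml !mulr_sumr -sumrB -big_split; apply: eq_bigr => k _ /=.
rewrite /sqn /dot !mulr_sumr -sumrB -big_split; apply: eq_bigr => i _ /=.
by rewrite !mxE; ring.
Qed.

Lemma sumr_even_terms_le (H : nat) (a : nat -> int) : (forall k, 0 <= a k) ->
  \sum_(h < H) a (2 * h)%N <= \sum_(k < 2 * H) a k.
Proof.
move=> a0; elim: H => [|H IHH]; first by rewrite !big_ord0.
rewrite mulnS addnC addn2 !big_ord_recr /= -addrA lerD //.
by rewrite lerDl.
Qed.

(** A path along a tube alternates between full and half full cells, and a step out of a full cell
    is wanted; hence the even index. Discarding the odd terms costs a factor 2 against the plain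
    average. *)
Lemma exists_small_even_term (H : nat) (a : nat -> int) (T : int) :
    (0 < H)%N -> (forall k, 0 <= a k) -> \sum_(k < 2 * H) a k <= T ->
  exists2 h, (h < H)%N & a (2 * h)%N * H%:Z <= T.
Proof.
move=> H0 a0 leT; apply: contrapT => noh.
have big (h : 'I_H) : T < a (2 * h)%N * H%:Z.
  by rewrite ltNge; apply/negP => le; apply: noh; exists h.
have : \sum_(h < H) T < \sum_(h < H) a (2 * h)%N * H%:Z.
  by apply: ltr_sum => //; apply/hasP; exists (Ordinal H0); rewrite ?mem_index_enum.
rewrite -mulr_suml sumr_const card_ord -mulr_natr natz ltr_pM2r ?ltz_nat //.
by rewrite ltNge (le_trans (sumr_even_terms_le H a0)).
Qed.

End Energy.

(** * Decay of the best stretch constant from scale to scale *)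

Definition steps (j : nat) : nat := 2 ^ (j + 6) * 2 ^ j.+1.

Lemma widthSE j : width j.+1 = (steps j * width j)%N.
Proof. by rewrite widthS /gap -mulnA mulnC. Qed.

(** Here [a], [s], [t] stand for [sum |v k|^2], [|F|^2] and [<sum v k, F>]. The energy splits into
    [N (N a - s)] and [2 N (s - t)]. The first is small because the successive bounds
    [A K / (K + c)] and [A K / (K + c + 1)] differ by at most [A / K], the second because [F] is
    nearly the sum of the steps. *)
Lemma stretch_energy_arith (A K a s t N v gp c : int) :
    0 <= A -> 0 < K ->    0 <= N -> 0 <= v -> 0 <= gp -> 0 <= c ->
    a * (K + c) <= N * (A * K * v ^+ 2) ->
    A * K * (N * v) ^+ 2 < s * (K + c + 1) ->
    s - t <= A * (2 * gp * (N * v)) ->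
    4 * K * gp <= N * v ->
  K * (N ^+ 2 * a - 2 * N * t + N * s) <= 2 * N * (N * v) ^+ 2 * A.
Proof.
move=> A0 K0 N0 v0 g0 c0 ha hs ht hg.
set W := N * v in hs ht hg *.
have W0 : 0 <= W by rewrite mulr_ge0.
have err : K * (2 * N * (s - t)) <= N * A * W ^+ 2.
  apply: (@le_trans _ _ (K * (2 * N * (A * (2 * gp * W))))).
    by rewrite ler_wpM2l ?ler_wpM2l ?mulr_ge0 // ltW.
  have -> : K * (2 * N * (A * (2 * gp * W))) = N * A * W * (4 * K * gp) by ring.
  by rewrite expr2 [leRHS]mulrA ler_wpM2l ?mulr_ge0.
have main : K * (N ^+ 2 * a - N * s) <= N * A * W ^+ 2.
  set T := _ - _.
  have hT : T * ((K + c) * (K + c + 1)) <= K * (N * A * W ^+ 2).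
    have -> : T * ((K + c) * (K + c + 1))
       = N ^+ 2 * (a * (K + c)) * (K + c + 1) - N * (K + c) * (s * (K + c + 1)).
      by rewrite /T; ring.
    have -> : K * (N * A * W ^+ 2) = N ^+ 2 * (N * (A * K * v ^+ 2)) * (K + c + 1)
         - N * (K + c) * (A * K * W ^+ 2) by rewrite /W; ring.
    apply: lerB.
      by rewrite ler_wpM2r ?ler_wpM2l ?sqr_ge0 //; lia.
    by rewrite ler_wpM2l ?mulr_ge0 ?(ltW hs) //; lia.
  have [T0|T0] := ltP T 0.
    apply: (@le_trans _ _ 0); first by rewrite pmulr_rle0 // ltW.
    by rewrite !mulr_ge0 ?sqr_ge0.
  rewrite -(ler_pM2l K0); apply: le_trans hT.
  rewrite [leRHS]mulrC mulrA ler_wpM2r //.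
  by rewrite ler_pM ?(ltW K0) //; lia.
have -> : K * (N ^+ 2 * a - 2 * N * t + N * s)
    = K * (N ^+ 2 * a - N * s) + K * (2 * N * (s - t)) by ring.
have -> : 2 * N * W ^+ 2 * A = N * A * W ^+ 2 + N * A * W ^+ 2 by ring.
exact: lerD.
Qed.

(** This is where the size of [K] comes from: [1024 * 1024 = 16 * 4 * 128 ^ 2] and [d ^ 3 * L ^ 4]
    is [d L ^ 2] times [(d L) ^ 2]. *)
Lemma bad_count_arith (K B C d L v r : nat) :
    (0 < d)%N -> (0 < L)%N -> (0 < r)%N ->
    (K * B * r ^ 2 <= 4 * C * (d * L ^ 2) * v ^ 2)%N ->
    (1024 * (1024 * (d ^ 3 * L ^ 4)) <= K)%N -> (v <= 128 * (d * L * r))%N ->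
  (16 * B <= C)%N.
Proof.
move=> d0 L0 r0 hB hK hv.
have E0 : (0 < 64 * 1024 * (d ^ 3 * L ^ 4) * r ^ 2)%N.
  by rewrite !muln_gt0 ?expn_gt0 d0 L0 r0.
rewrite -(leq_pmul2r E0).
have h1 : (16 * B * (64 * 1024 * (d ^ 3 * L ^ 4) * r ^ 2) <= K * B * r ^ 2)%N.
  have -> : (16 * B * (64 * 1024 * (d ^ 3 * L ^ 4) * r ^ 2)
    = 1024 * (1024 * (d ^ 3 * L ^ 4)) * (B * r ^ 2))%N by ring.
  by rewrite -[leqRHS]mulnA leq_mul2r hK orbT.
apply: (leq_trans h1); apply: (leq_trans hB).
have -> : (C * (64 * 1024 * (d ^ 3 * L ^ 4) * r ^ 2)
  = 4 * C * (d * L ^ 2) * (128 * (d * L * r)) ^ 2)%N by ring.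
by rewrite leq_mul2l leq_exp2r // hv orbT.
Qed.

Lemma scaled_bad_count (K B N r C A v : nat) : (0 < N%:Z) ->
    K%:Z * (B%:Z * (N * r)%:Z ^+ 2) <= 4 * C%:Z * A%:Z * (N%:Z * v%:Z) ^+ 2 ->
  (K * B * r ^ 2 <= 4 * C * A * v ^ 2)%N.
Proof.
move=> N0; have -> : K%:Z * (B%:Z * (N * r)%:Z ^+ 2) = (K * B * r ^ 2)%:Z * N%:Z ^+ 2.
  by rewrite !PoszM; ring.
have -> : 4 * C%:Z * A%:Z * (N%:Z * v%:Z) ^+ 2 = (4 * C * A * v ^ 2)%:Z * N%:Z ^+ 2.
  by rewrite !PoszM; ring.
by rewrite ler_pM2r ?exprn_gt0.
Qed.

Lemma normr_divz_le (B : int) (N : nat) (F : int) :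
  0 < N%:Z -> `|F| <= N%:Z * B -> `|(F %/ N%:Z)%Z| <= B.
Proof.
move=> N0 FB; have FE := divz_eq F N%:Z; have F0 := modz_ge0 F (lt0r_neq0 N0).
have F1 := ltz_pmod F N0; move: FB FE F0 F1.
move: (F %/ _)%Z (F %% _)%Z => q m; move: N0; move: N%:Z; clear => N.
by case: (lerP 0 q) => q0; nia.
Qed.

Lemma normr_sub_divz_le (r N : nat) (v F : int) :
  0 < N%:Z -> `|N%:Z * v - F| <= N%:Z * r%:Z -> `|v - (F %/ N%:Z)%Z| <= r%:Z + 1.
Proof.
move=> N0 FB; have FE := divz_eq F N%:Z; have F0 := modz_ge0 F (lt0r_neq0 N0).
have F1 := ltz_pmod F N0; move: FB FE F0 F1.
move: (F %/ _)%Z (F %% _)%Z r%:Z => q m {}r; move: N0; move: N%:Z; clear => N.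
nia.
Qed.

Lemma leq_double_trunc (a v : nat) :
  (0 < a)%N -> (a <= v)%N -> (v <= 2 * a * (v %/ a))%N.
Proof.
move=> a0 av; have := ltn_ceil v a0; have : (0 < v %/ a)%N by rewrite divn_gt0.
by move: (v %/ a)%N => q; nia.
Qed.

(** Half of the allowed distance [v / (32 d)] is spent on [L] times the deviation
    [v %/ (64 * d * L)] of a step; the other half absorbs the remaining terms. *)
Lemma closeness_arith (d L v : nat) : (0 < d)%N -> (0 < L)%N ->
    (64 * d * (L ^ 2 + L + 2) <= v)%N ->
  (L * (L + (v %/ (64 * d * L)) + 1) + 1 <= v %/ (32 * d))%N.
Proof.
move=> d0 L0 hv; set r := (v %/ _)%N.
have rv : (r * (64 * d * L) <= v)%N by exact: leq_trunc_div.
rewrite leq_divRL; last by rewrite muln_gt0.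
nia.
Qed.

Section Stretch.

Variables (d : nat) (i0 i1 : 'I_d).
Hypothesis i01 : i0 != i1.
Variables (f g : 'rV[int]_d -> 'rV[int]_d) (L J K : nat).

Let w n : int := (width n)%:Z.
Let A : nat := (d * L ^ 2)%N.

Hypothesis L_gt0 : (0 < L)%N.
Hypothesis K_gt0 : (0 < K)%N.
Hypothesis fK : forall x, int_net i0 i1 x -> g (f x) = x.
Hypothesis gK : forall y, f (g y) = y.
Hypothesis g_net : forall y, int_net i0 i1 (g y).
Hypothesis f_lip : forall r x y, int_net i0 i1 x -> int_net i0 i1 y ->
  close (4 * w J) 0 x -> close (4 * w J) 0 y ->
  close r x y -> close (L%:Z * r) (f x) (f y).
(** The radius leaves room for [f y + W]: [f] maps net points of its box to within [4 L w J] of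
    [f 0], and the coordinates of [W] will be at most [L w J]. *)
Hypothesis g_lip : forall r x y,
  close (8 * L%:Z * w J) (f 0) x -> close (8 * L%:Z * w J) (f 0) y ->
  close r x y -> close (L%:Z * r) (g x) (g y).

(* At scale j0 + c the squared stretch is at most d L^2 / (1 + c / K). *)
Definition stretch_le (j c : nat) : Prop := forall x : 'rV[int]_d,
  (2 %| x 0%R i0)%Z -> close (4 * w J - 4 * w j) 0 x ->
  sqn (f (x + axis i0 (w j)) - f x) * (K + c)%:Z <= A%:Z * K%:Z * w j ^+ 2.

Let even_net (x : 'rV[int]_d) : (2 %| x 0%R i0)%Z -> int_net i0 i1 x.
Proof. by left. Qed.

Let d_gt0 : (0 < d)%N.
Proof. exact: leq_ltn_trans (leq0n _) (ltn_ord i0). Qed.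

Let even_width j : (2 %| w j)%Z.
Proof. by rewrite /w /width dvdzE dvdn_exp // addnS expn_gt0. Qed.

Let even_axis (x : 'rV[int]_d) (c : int) :
  (2 %| x 0%R i0)%Z -> (2 %| c)%Z -> (2 %| (x + axis i0 c) 0%R i0)%Z.
Proof. by move=> x2 c2; rewrite mxE axisE eqxx rpredD. Qed.

Let width_le_gap j : 64 * w j <= (gap j)%:Z.
Proof.
by rewrite /w /gap expnD (_ : 2 ^ 6 = 64)%N //; have := expn_gt0 2 j; nia.
Qed.

(** The radius [4 w J - 4 w j] grows as the scale gets finer, by enough to pay for the shift by
    [gap j] and for a path of length up to [w j.+1]. *)
Lemma path_box (j : nat) (x z : 'rV[int]_d) (k : nat) :
    close (4 * w J - 4 * w j.+1) 0 x -> close (gap j)%:Z z x -> (k <= steps j)%N ->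
  close (4 * w J - 4 * w j) 0 (z + axis i0 (k%:Z * w j)).
Proof.
move=> xJ zx kN i; have := xJ i; have := zx i; rewrite !mxE.
have wS : w j.+1 = (steps j)%:Z * w j by rewrite /w widthSE PoszM.
have wg : 2 * (gap j)%:Z <= w j.+1 by have := double_width_leS j; rewrite /w; lia.
have gw := width_le_gap j.
have v0 : 0 < w j by rewrite /w ltz_nat width_gt0.
have : 0 <= k%:Z * w j <= w j.+1.
  apply/andP; split; first by rewrite mulr_ge0 // ltW.
  by rewrite wS ler_wpM2r // ?lez_nat // ltW.
move: (x 0 i : int) (z 0 i : int) (k%:Z * w j : int) => xi zi kv.
by case: (i == i0); lia.
Qed.

Lemma axis_step_le (j : nat) (x : 'rV[int]_d) (i : 'I_d) :
    (2 %| x 0%R i0)%Z -> close (4 * w J - 4 * w j) 0 x ->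
  `|(f (x + axis i0 (w j)) - f x) 0 i| <= L%:Z * w j.
Proof.
move=> x2 xJ; have v0 : 0 < w j by rewrite /w ltz_nat width_gt0.
have xbox : close (4 * w J) 0 x by apply: close_le xJ; clear -v0; lia.
have : close (L%:Z * w j) (f (x + axis i0 (w j))) (f x).
  apply: f_lip => //; try by apply: even_net => //; apply: even_axis.
    move=> l; have := xJ l; rewrite !mxE; move: (x 0 l : int) => xl.
    by clear -v0; case: (l == i0); lia.
  by move=> l; rewrite !mxE; move: (x 0 l : int) => xl; clear -v0; case: (l == i0); lia.
by move/(_ i); rewrite !mxE.
Qed.

(* If [F] is almost maximal then the sum over the steps [v k] of
   |N v k - F|^2 = N^2 |v k|^2 - 2 N <v k, F> + |F|^2 is small. *)
Lemma path_energy (j c : nat) (x z : 'rV[int]_d) :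
    (4 * K <= 2 ^ j.+1)%N -> stretch_le j c ->
    (2 %| x 0%R i0)%Z -> (2 %| z 0%R i0)%Z ->
    close (4 * w J - 4 * w j.+1) 0 x -> close (gap j)%:Z z x ->
    A%:Z * K%:Z * w j.+1 ^+ 2
      < sqn (f (x + axis i0 (w j.+1)) - f x) * (K + c.+1)%:Z ->
  K%:Z * (\sum_(k < steps j)
    sqn ((steps j)%:Z *: (f (z + axis i0 (k.+1%:Z * w j)) - f (z + axis i0 (k%:Z * w j)))
         - (f (x + axis i0 (w j.+1)) - f x)))
  <= 2 * (steps j)%:Z * w j.+1 ^+ 2 * A%:Z.
Proof.
move=> Kj hj x2 z2 xJ zx; set F := f (x + _) - f x => hF.
pose N := steps j.
pose v k := f (z + axis i0 (k.+1%:Z * w j)) - f (z + axis i0 (k%:Z * w j)).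
have wS : w j.+1 = N%:Z * w j by rewrite /w widthSE PoszM.
have wg : 2 * (gap j)%:Z <= w j.+1 by have := double_width_leS j; rewrite /w; lia.
have gw := width_le_gap j.
have v0 : 0 < w j by rewrite /w ltz_nat width_gt0.
have zbox k := @path_box j x z k xJ zx.
have box k : (k <= N)%N -> close (4 * w J) 0 (z + axis i0 (k%:Z * w j)).
  by move=> kN; apply: close_le (zbox k kN); lia.
have xbox : close (4 * w J) 0 x by apply: close_le xJ; lia.
have xwbox : close (4 * w J) 0 (x + axis i0 (w j.+1)).
  by move=> i; have := xJ i; rewrite !mxE; move: (x 0 i : int) => xi; case: (i == i0); lia.
have zev k : (2 %| (z + axis i0 (k%:Z * w j)) 0%R i0)%Z.
  by apply: even_axis => //; rewrite dvdz_mull.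
have sumv : \sum_(k < N) v k = f (z + axis i0 (w j.+1)) - f z.
  rewrite -(big_mkord xpredT v) telescope_sumr // -wS mul0r.
  by congr (_ - f _); apply/rowP => i; rewrite !mxE; case: ifP; rewrite addr0.
rewrite [X in _ * X](sum_sqn_scale_sub N N%:Z v F) wS.
apply: (@stretch_energy_arith _ _ _ _ _ _ _ (gap j)%:Z c%:Z) => //.
- have -> : N%:Z * (A%:Z * K%:Z * w j ^+ 2) = \sum_(k < N) A%:Z * K%:Z * w j ^+ 2.
    by rewrite sumr_const card_ord -mulr_natl natz.
  rewrite -PoszD mulr_suml; apply: ler_sum => k _.
  have -> : v k = f (z + axis i0 (k%:Z * w j) + axis i0 (w j))
      - f (z + axis i0 (k%:Z * w j)).
    rewrite /v (_ : k.+1%:Z * w j = k%:Z * w j + w j) ?axisD ?addrA //.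
    by rewrite intS mulrDl mul1r addrC.
  by apply: hj => //; apply: zbox; apply: ltnW.
- by rewrite -wS (_ : K%:Z + c%:Z + 1 = (K + c.+1)%:Z) //; lia.
- rewrite -wS sumv; set V := _ - f z.
  have -> : sqn F - dot V F = dot (F - V) F.
    by rewrite /sqn /dot -sumrB; apply: eq_bigr => i _; rewrite !mxE; ring.
  apply: le_trans (ler_norm _) _.
  (* The path runs parallel to the segment at distance at most [gap j], so each of its two ends
     contributes an error [L * gap j]. *)
  have hFV i : `|(F - V) 0 i| <= 2 * (L%:Z * (gap j)%:Z).
    have h1 : close (L%:Z * (gap j)%:Z) (f z) (f x).
      have := box 0%N (leq0n _) => bz; apply: f_lip => //; try exact: even_net.
      by move=> l; have := bz l; rewrite !mxE mul0r; case: ifP; rewrite addr0.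
    have h2 : close (L%:Z * (gap j)%:Z) (f (z + axis i0 (w j.+1))) (f (x + axis i0 (w j.+1))).
      apply: f_lip => //; try by apply: even_net; apply: even_axis.
        by rewrite wS; exact: box.
      by move=> l; have := zx l; rewrite !mxE; move: (x 0 l : int) (z 0 l : int) => xl zl;
        case: (l == i0); lia.
    have := h1 i; have := h2 i; rewrite /F /V !mxE.
    move: (f (z + _) 0 i : int) (f (x + _) 0 i : int) (f z 0 i : int) (f x 0 i : int).
    by move: (L%:Z * _ : int) => B a b c' e; lia.
  have hFF i := @axis_step_le j.+1 x i x2 xJ.
  apply: (le_trans (dot_le hFV hFF)); rewrite le_eqVlt; apply/orP; left; apply/eqP.
  by rewrite /A PoszM -[(L ^ 2)%N]mulnn PoszM; ring.
(* The ratio [2 ^ j.+1] of [width j.+1] to [gap j] dominates [4 K], so moving to a nearby tube is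
   harmless. *)
- by rewrite -wS /w widthS PoszM mulrC ler_wpM2l.
Qed.

(** Making coordinate [i0] even moves the point by at most 1 and puts it in the net whatever the
    tubes are; since [w j] is even, the whole path from it then stays in the net. *)
Definition even_corner (v : nat) (p : 'rV[int]_d) (u : {ffun 'I_d -> 'I_v}) :=
  p + offset u - axis i0 ((u i0)%:Z %% 2)%Z.

Lemma exists_aligned_cell (j : nat) (x : 'rV[int]_d) : exists p : 'rV[int]_d,
  [/\ ((2 * width j)%:Z %| p 0%R i0)%Z, ((gap j)%:Z %| p 0%R i1)%Z &
      forall u : {ffun 'I_d -> 'I_(width j)},
      (2 %| even_corner p u 0%R i0)%Z /\ close (gap j)%:Z (even_corner p u) x].
Proof.
have gw := width_le_gap j.
have v0 : 0 < w j by rewrite /w ltz_nat width_gt0.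
(* Coordinate [i0] is rounded so that the cell is a full one, coordinate [i1] so that it lies in a
   tube; the others need no alignment. *)
pose p : 'rV[int]_d := \row_i (if i == i0
  then (x 0%R i %/ (2 * width j)%:Z)%Z * (2 * width j)%:Z
  else if i == i1 then (x 0%R i %/ (gap j)%:Z)%Z * (gap j)%:Z else x 0 i).
have pi0 : p 0 i0 = (x 0%R i0 %/ (2 * width j)%:Z)%Z * (2 * width j)%:Z.
  by rewrite mxE eqxx.
have pi1 : p 0 i1 = (x 0%R i1 %/ (gap j)%:Z)%Z * (gap j)%:Z.
  by rewrite mxE eq_sym (negbTE i01) eqxx.
exists p; rewrite pi0 pi1 !dvdz_mull //; split=> //.
have zE (u : {ffun 'I_d -> 'I_(width j)}) i : even_corner p u 0 i =
    p 0 i + (u i : nat)%:Z - (if i == i0 then ((u i0)%:Z %% 2)%Z else 0).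
  have addE (a b : 'rV[int]_d) : (a + b) 0 i = a 0 i + b 0 i by rewrite mxE.
  have oppE (a : 'rV[int]_d) : (- a) 0 i = - a 0 i by rewrite mxE.
  by rewrite /even_corner !addE oppE offsetE axisE.
move=> u; split.
  rewrite zE eqxx pi0 PoszM.
  move: (x 0%R i0 %/ _)%Z => q; lia.
  move=> i; rewrite zE mxE.
  have := ltn_ord (u i); move: gw v0; rewrite /w.
  have := divz_eq (x 0 i) (2 * width j)%:Z; have := divz_eq (x 0 i) (gap j)%:Z.
  have := @ltz_pmod (x 0 i) (2 * width j)%:Z; have := @ltz_pmod (x 0 i) (gap j)%:Z.
  have := @modz_ge0 (x 0 i) (2 * width j)%:Z; have := @modz_ge0 (x 0 i) (gap j)%:Z.
  move: (x 0%R i %/ _)%Z (x 0%R i %/ _)%Z (x 0%R i %% _)%Z (x 0%R i %% _)%Z.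
  move: (width_gt0 j) (gap_gt0 j) (x 0 i : int) => + + xi.
  have [->|_] := eqVneq i i0.
    by lia.
  by case: (i == i1); lia.
Qed.

(** As [y] is within 1 of a vertex of the path, [f y + W] is within [L + rho] of the image of the
    next vertex. Applying [g] multiplies this by [L], and returning from that vertex to the
    translate of [y] costs 1 more. *)
Lemma translation_close (j k : nat) (rho : int) (x y z W : 'rV[int]_d) :
    (j < J)%N -> (k < steps j)%N ->
    close (4 * w J - 4 * w j.+1) 0 x -> close (gap j)%:Z z x ->
    (2 %| z 0%R i0)%Z -> int_net i0 i1 y -> close 1 y (z + axis i0 (k%:Z * w j)) ->
    (forall i, `|W 0 i| <= L%:Z * w j) ->
    close rho (f (z + axis i0 (k.+1%:Z * w j)) - f (z + axis i0 (k%:Z * w j))) W ->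
  close (L%:Z * (L%:Z + rho) + 1) (g (f y + W)) (y + axis i0 (w j)).
Proof.
move=> jJ kN xJ zx z2 ynet yz WL vW.
have v0 : 0 < w j by rewrite /w ltz_nat width_gt0.
have wjJ : w j <= w J by rewrite /w lez_nat width_mono // ltnW.
have hb := path_box xJ zx (ltnW kN); have hb' := path_box xJ zx kN.
have ybox : close (4 * w J) 0 y.
  by apply: close_le (close_trans hb (closeC yz)); clear -v0; lia.
have zbox : close (4 * w J) 0 (z + axis i0 (k%:Z * w j)).
  by apply: close_le hb; clear -v0; lia.
have zbox' : close (4 * w J) 0 (z + axis i0 (k.+1%:Z * w j)).
  by apply: close_le hb'; clear -v0; lia.
have zev n : int_net i0 i1 (z + axis i0 (n%:Z * w j)).
  by apply: even_net; apply: even_axis => //; rewrite dvdz_mull.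
have net0 : int_net i0 i1 0 by apply: even_net; rewrite mxE.
have box0 : close (4 * w J) 0 (0 : 'rV[int]_d).
  by move=> i; rewrite subrr normr0 mulr_ge0 // ltW // ltz_nat width_gt0.
have fyz := f_lip ynet (zev _) ybox zbox yz.
set Y := z + axis i0 (k.+1%:Z * w j) in vW zbox' *.
have close_im : close (L%:Z + rho) (f y + W) (f Y).
  move=> i; have := fyz i; have := vW i; rewrite !mxE.
  move: (f y 0 i : int) (W 0 i : int) (f Y 0 i : int) (f (z + _) 0 i : int) => a b c e.
  by clear; lia.
have Lw : L%:Z * w j <= L%:Z * w J by rewrite ler_wpM2l.
have Lw0 : 0 <= L%:Z * w j by rewrite mulr_ge0 // ltW.
have fYbox : close (8 * L%:Z * w J) (f 0) (f Y).
  apply: close_le (f_lip net0 (zev _) box0 zbox' zbox').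
  by rewrite mulrCA -mulrA; move: Lw Lw0; move: (_ * w j) (_ * w J) => a b; clear; lia.
have fyWbox : close (8 * L%:Z * w J) (f 0) (f y + W).
  have f0y := f_lip net0 ynet box0 ybox ybox; move=> i; have := f0y i; have := WL i.
  rewrite !mxE mulrCA -[8 * _ * _]mulrA; move: Lw Lw0.
  move: (f 0 0 i : int) (f y 0 i : int) (W 0 i : int) (_ * w j : int) (_ * w J : int).
  by clear; lia.
have gY := g_lip fyWbox fYbox close_im; rewrite fK in gY; last exact: zev.
apply: close_trans gY _ => i; have := yz i; rewrite /Y !mxE.
move: (z 0 i : int) (y 0 i : int) => a b; rewrite intS mulrDl mul1r.
by move: (k%:Z * w j : int) (w j) => e u; clear; case: (i == i0); lia.
Qed.

(** If the bound failed at [x], the paths from all points of one cell near [x] would have small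
    energy. Averaging over steps and points together yields one even step that is nearly [F / N] for
    most of the cell, which [no_uniform_translation] forbids. *)
Lemma stretch_step (j c : nat) :
    (1024 * (1024 * (d ^ 3 * L ^ 4)) <= K)%N -> (4 * K <= 2 ^ j.+1)%N ->
    (64 * d * (L ^ 2 + L + 2) <= width j)%N -> (j < J)%N ->
  stretch_le j c -> stretch_le j.+1 c.+1.
Proof.
move=> KL Kj vL jJ hj x x2 xJ; rewrite leNgt; apply/negP.
set F := f (x + _) - f x => hF.
pose N := steps j; pose H := (2 ^ (j + 5) * 2 ^ j.+1)%N.
have NH : N = (2 * H)%N by rewrite /N /steps /H addnS expnS mulnA.
have H0 : (0 < H)%N by rewrite muln_gt0 !expn_gt0.
have N0 : 0 < N%:Z by rewrite NH ltz_nat muln_gt0.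
have wS : w j.+1 = N%:Z * w j by rewrite /w widthSE PoszM.
have gw := width_le_gap j.
have wg : 2 * (gap j)%:Z <= w j.+1 by have := double_width_leS j; rewrite /w; lia.
have v0 : 0 < w j by rewrite /w ltz_nat width_gt0.
have wJ : w j.+1 <= w J by rewrite /w lez_nat width_mono.
have [p [p0 p1 zP]] := exists_aligned_cell j x.
pose cube := {ffun 'I_d -> 'I_(width j)}; pose C := #|{: cube}|.
pose z (u : cube) := even_corner p u.
pose vk k u := f (z u + axis i0 (k.+1%:Z * w j)) - f (z u + axis i0 (k%:Z * w j)).
pose a k := \sum_(u : cube) sqn (N%:Z *: vk k u - F).
have a0 k : 0 <= a k by apply: sumr_ge0 => u _; exact: sqn_ge0.
have suma : \sum_(k < 2 * H) K%:Z * a k <= C%:Z * (2 * N%:Z * w j.+1 ^+ 2 * A%:Z).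
  rewrite -mulr_sumr exchange_big mulr_sumr.
  apply: (@le_trans _ _ (\sum_(u : cube) 2 * N%:Z * w j.+1 ^+ 2 * A%:Z)).
    apply: ler_sum => u _; have [zu zx] := zP u; rewrite -NH.
    exact: (path_energy Kj hj x2 zu xJ zx hF).
  by rewrite sumr_const -[C]/#|cube| -[leLHS]mulr_natl natz lexx.
have [h hH ah] : exists2 h, (h < H)%N
    & K%:Z * a (2 * h)%N <= 4 * C%:Z * A%:Z * w j.+1 ^+ 2.
  have Ka0 k : 0 <= K%:Z * a k by rewrite mulr_ge0.
  have [h hH hh] := exists_small_even_term H0 Ka0 suma.
  exists h => //; rewrite -(@ler_pM2r _ H%:Z) ?ltz_nat //; apply: le_trans hh _.
  by rewrite NH PoszM le_eqVlt; apply/orP; left; apply/eqP; ring.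
(* [r'] is the deviation from [F / N] tolerated in a step, [r] the error this may cause after
   applying [g]. *)
pose r' := (width j %/ (64 * d * L))%N; pose r := (width j %/ (32 * d))%N.
pose bad := [set u : cube |
  [exists i, (N * r')%:Z < `|(N%:Z *: vk (2 * h)%N u - F) 0 i|]].
(* The mean step rounded down to an integer vector; the rounding adds 1 to the deviation [r']. *)
pose W : 'rV[int]_d := \row_i (F 0%R i %/ N%:Z)%Z.
have hN : (2 * h < N)%N by rewrite NH ltn_pmul2l.
have cbad : (16 * #|bad| <= C)%N.
  have dL0 : (0 < 64 * d * L)%N by rewrite !muln_gt0 d_gt0 L_gt0.
  have dLv : (64 * d * L <= width j)%N.
    apply: leq_trans vL; rewrite leq_mul2l -addnA addnCA leq_addr orbT //.
  have r'0 : (0 < r')%N by rewrite divn_gt0.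
  apply: (bad_count_arith d_gt0 L_gt0 r'0 _ KL (v := width j)); last first.
    have := leq_double_trunc dL0 dLv; rewrite -/r'.
    by rewrite (_ : 2 * (64 * d * L) * r' = 128 * (d * L * r'))%N //; ring.
  (* Markov's inequality: every bad [u] contributes at least [(N r') ^ 2] to the energy. *)
  have le_a : #|bad|%:Z * (N * r')%:Z ^+ 2 <= a (2 * h)%N.
    rewrite -natz mulr_natl -sumr_const /a [leRHS](bigID (mem bad)) /=.
    rewrite -[leLHS]addr0 lerD //; last by apply: sumr_ge0 => u _; exact: sqn_ge0.
    apply: ler_sum => u; rewrite inE => /existsP[i hi].
    apply: le_trans (sqn_ge_coord _ i); rewrite -[leRHS]real_normK ?num_real //.
    by rewrite ler_sqr ?nnegrE // ltW.
  have : K%:Z * (#|bad|%:Z * (N * r')%:Z ^+ 2) <= 4 * C%:Z * A%:Z * w j.+1 ^+ 2.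
    by apply: le_trans ah; rewrite ler_wpM2l.
  by rewrite wS; apply: scaled_bad_count.
have p1' : (p + axis i0 ((2 * h)%:Z * w j)) 0 i1 = p 0 i1.
  by rewrite mxE axisE eq_sym (negbTE i01) addr0.
apply: (@no_uniform_translation d i0 i1 i01 j r (p + axis i0 ((2 * h)%:Z * w j)) bad
  (fun u => g (f (p + axis i0 ((2 * h)%:Z * w j) + offset u) + W))).
- by rewrite mxE axisE eqxx rpredD // /w -PoszM mulnAC dvdzE dvdn_mulr.
- by rewrite p1'.
- by rewrite mulnC leq_trunc_div.
- exact: cbad.
- move=> u ub ynet; set y := p + _ + _ in ynet *.
  have [zu zx] := zP u.
  have yz : close 1 y (z u + axis i0 ((2 * h)%:Z * w j)).
    move=> i; rewrite /y /z /even_corner !mxE.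
    move: (p 0 i : int) ((u i : nat)%:Z) ((2 * h)%:Z * w j : int) => q b e.
    by move: (u i0 : nat) => n; clear; case: (i == i0); lia.
  split; first exact: g_net.
  apply: close_le (translation_close (rho := r'%:Z + 1) jJ hN xJ zx zu ynet yz _ _).
  - have := closeness_arith d_gt0 L_gt0 vL; rewrite -/r' -/r -lez_nat.
    by rewrite !PoszD !PoszM !PoszD addrA.
  - move=> i; have Fi := @axis_step_le j.+1 x i x2 xJ.
    rewrite mxE; apply: (@normr_divz_le _ N) => //.
    by rewrite mulrCA -wS.
  - move=> i; move: ub; rewrite inE => /existsPn/(_ i); rewrite -leNgt => vFi.
    move: vFi; rewrite PoszM [W 0 i]mxE !mxE; exact: normr_sub_divz_le.
- move=> u t _ _ unet tnet /(congr1 f); rewrite !gK => /addIr /(congr1 g).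
  rewrite !fK // => /addrI /rowP ut.
  by apply/ffunP => i; apply/val_inj; have := ut i; rewrite !offsetE => -[].
Qed.

(** Otherwise the Lipschitz bound for [g] would bring the two image points back to a distance less
    than [w J]. *)
Lemma exists_stretched_coord : exists i, w J <= L%:Z * `|(f (0 + axis i0 (w J)) - f 0) 0 i|.
Proof.
have v0 : 0 < w J by rewrite /w ltz_nat width_gt0.
have v1 := width_gt0 J.
have z2 : (2 %| (0%R : 'rV[int]_d) 0%R i0)%Z by rewrite mxE.
have zJ : close (4 * w J - 4 * w J) 0 (0 : 'rV[int]_d).
  by move=> i; rewrite !subrr normr0.
have Lw0 : 0 <= L%:Z * w J by rewrite mulr_ge0 // ltW.
apply: contrapT => noi.
(* With [width J - 1] in place of [width J] the inequality remains strict after multiplying the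
   quotient by [L]. *)
have small i : `|(f (0 + axis i0 (w J)) - f 0) 0 i| <= ((width J).-1 %/ L)%:Z.
  have ltw : L%:Z * `|(f (0 + axis i0 (w J)) - f 0) 0 i| < w J.
    by rewrite ltNge; apply/negP => le; apply: noi; exists i.
  move: ltw; move: ((f _ - f 0) 0 i : int) => a; rewrite /w -[`|a|]abszE -PoszM ltz_nat.
  by rewrite lez_nat leq_divRL // mulnC => ltw; rewrite -ltnS prednK.
have box0 : close (8 * L%:Z * w J) (f 0) (f 0).
  by move=> i; rewrite subrr normr0 -mulrA mulr_ge0.
have boxw : close (8 * L%:Z * w J) (f 0) (f (0 + axis i0 (w J))).
  apply: closeC => i; have := axis_step_le i z2 zJ; rewrite -mulrA mxE [(- f 0) 0 i]mxE.
  by move=> /le_trans; apply; rewrite ler_peMl.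
have netw : int_net i0 i1 (0 + axis i0 (w J)) by apply: even_net; apply: even_axis.
have cl : close ((width J).-1 %/ L)%:Z (f (0 + axis i0 (w J))) (f 0).
  by move=> i; have := small i; rewrite mxE [(- f 0) 0 i]mxE.
have := g_lip boxw box0 cl; rewrite !fK //; last exact: even_net.
move/(_ i0); rewrite !mxE eqxx add0r subr0 gtr0_norm // -PoszM lez_nat.
by rewrite leqNgt mulnC (leq_ltn_trans (leq_trunc_div _ _)) // prednK.
Qed.

(** The Lipschitz bound is the case [c = 0] at scale [J0], and [J0] applications of [stretch_step]
    reach scale [J]. Against the lower bound for the stretch there, this gives
    [K + J0 <= d L ^ 4 K <= J0]. *)
Lemma no_bilipschitz_bijection (J0 : nat) :
    (1024 * (1024 * (d ^ 3 * L ^ 4)) <= K)%N -> (4 * K <= 2 ^ J0)%N ->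
    (64 * d * (L ^ 2 + L + 2) <= width J0)%N -> (d * L ^ 4 * K <= J0)%N ->
    (J = J0 + J0)%N ->
  False.
Proof.
move=> KL KJ vL LJ JE.
have stretch c : (c <= J0)%N -> stretch_le (J0 + c) c.
  elim: c => [_|c IHc cJ].
    move=> x x2 xJ; rewrite !addn0 in xJ *.
    have := sqn_le (fun i => axis_step_le i x2 xJ) => le_s.
    rewrite -[A%:Z * _ * _]mulrAC ler_wpM2r //; apply: le_trans le_s _.
    by rewrite exprMn mulrA /A PoszM -mulnn PoszM expr2.
  rewrite addnS; apply: stretch_step => //; last by apply: IHc; exact: ltnW.
  - by apply: (leq_trans KJ); rewrite leq_pexp2l // -addnS leq_addr.
  - by apply: (leq_trans vL); rewrite width_mono // leq_addr.
  - by rewrite JE ltn_add2l.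
have [i wi] := exists_stretched_coord.
have z2 : (2 %| (0%R : 'rV[int]_d) 0%R i0)%Z by rewrite mxE.
have zJ : close (4 * w J - 4 * w J) 0 (0 : 'rV[int]_d).
  by move=> l; rewrite !subrr normr0.
have := stretch _ (leqnn J0); rewrite -JE => /(_ 0 z2 zJ).
set F := f _ - f 0 in wi *; have := sqn_ge_coord F i.
have v0 : 0 < w J by rewrite /w ltz_nat width_gt0.
have : w J ^+ 2 <= (L%:Z * `|F 0 i|) ^+ 2 by rewrite ler_sqr ?nnegrE ?(ltW v0) // mulr_ge0.
rewrite exprMn real_normK ?num_real // => h1 h2 h3.
have h4 : w J ^+ 2 * (K + J0)%:Z <= (d * L ^ 4 * K)%:Z * w J ^+ 2.
  apply: (@le_trans _ _ (L%:Z ^+ 2 * (sqn F * (K + J0)%:Z))).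
    rewrite mulrA ler_wpM2r //; apply: (le_trans h1).
    by rewrite ler_wpM2l ?sqr_ge0.
  apply: (@le_trans _ _ (L%:Z ^+ 2 * (A%:Z * K%:Z * w J ^+ 2))).
    by rewrite ler_wpM2l ?sqr_ge0.
  rewrite le_eqVlt; apply/orP; left; apply/eqP.
  by rewrite /A !PoszM; ring.
move: h4; rewrite mulrC ler_pM2r ?exprn_gt0 // lez_nat.
by rewrite leqNgt -addn1 => /negP; apply; have := K_gt0; lia.
Qed.

End Stretch.

(** * The net in Euclidean space and Lipschitz bounds on balls *)

Section EuclideanNet.

Variables (R : realType) (d : nat).
Implicit Types (x y : 'rV[int]_d).

Definition to_real (x : 'rV[int]_d) : 'rV[R]_d := map_mx intr x.

Lemma to_realE x i : to_real x 0 i = (x 0 i)%:~R.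
Proof. by rewrite mxE. Qed.

Lemma to_real_inj : injective to_real.
Proof.
move=> x y xy; apply/rowP => i; apply: (@intr_inj R).
by rewrite -!to_realE xy.
Qed.

Lemma ler_coord_enorm (z : 'rV[R]_d) i : `|z 0 i| <= enorm z.
Proof.
rewrite -sqrtr_sqr; apply: ler_wsqrtr; rewrite (bigD1 i) //= lerDl.
by apply: sumr_ge0 => j _; exact: sqr_ge0.
Qed.

Lemma enorm_le (z : 'rV[R]_d) (a : R) :
  0 <= a -> (forall i, `|z 0 i| <= a) -> enorm z <= d%:R * a.
Proof.
move=> a0 za; have da0 : 0 <= d%:R * a by rewrite mulr_ge0.
rewrite -(ger0_norm da0) -sqrtr_sqr; apply: ler_wsqrtr.
apply: (@le_trans _ _ (\sum_(i < d) a ^+ 2)).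
  by apply: ler_sum => i _; rewrite -real_normK ?num_real // ler_sqr ?nnegrE.
rewrite sumr_const card_ord -[leLHS]mulr_natl exprMn ler_wpM2r ?sqr_ge0 //.
by rewrite -natrX ler_nat; case: (d) => // n; rewrite leq_pmulr.
Qed.

Lemma enorm_to_real_ge1 x y : x != y -> 1 <= enorm (to_real y - to_real x).
Proof.
move=> xy; have [i xyi] : exists i, y 0 i != x 0 i.
  apply: contrapT => noi; move/eqP: xy; apply; apply/rowP => i.
  by apply: contrapT => xyi; apply: noi; exists i; rewrite eq_sym; apply/eqP.
apply: le_trans (ler_coord_enorm _ i); rewrite 3!mxE mxE -intrB -intr_norm.
by rewrite -[1]/(1%:~R) ler_int; move: xyi; move: (y 0 i : int) (x 0 i : int) => a b; lia.
Qed.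

Lemma enorm_to_real_le x y (r : int) :
  0 <= r -> close r y x -> enorm (to_real y - to_real x) <= d%:R * r%:~R.
Proof.
move=> r0 xy; apply: enorm_le => [|i]; first by rewrite ler0z.
by rewrite 3!mxE mxE -intrB -intr_norm ler_int.
Qed.

Definition real_net (i0 i1 : 'I_d) : set 'rV[R]_d :=
  [set to_real x | x in [set x | int_net i0 i1 x]]%classic.

(** Integer points are 1-separated, and the net contains every integer point with even coordinate
    [i0], one of which is within 2 of [z] in each coordinate. *)
Lemma real_net_separated (i0 i1 : 'I_d) : separated_net (real_net i0 i1).
Proof.
have d0 : (0 < d)%N by exact: leq_ltn_trans (leq0n _) (ltn_ord i0).
exists (d%:R * 2), 1; split; rewrite ?mulr_gt0 ?ltr0n //.
  move=> _ _ [x _ <-] [y _ <-] xy; apply: enorm_to_real_ge1.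
  by apply: contra_neq xy => ->.
move=> z; pose x : 'rV[int]_d :=
  \row_i (Num.floor (z 0%R i) - if i == i0 then (Num.floor (z 0%R i) %% 2)%Z else 0).
have xnet : int_net i0 i1 x.
  by left; rewrite mxE eqxx; move: (Num.floor _) => a; lia.
apply: (@le_trans _ _ (enorm (z - to_real x))%:E).
  by apply: ereal_inf_lbound; exists (to_real x) => //; exists x.
rewrite lee_fin; apply: enorm_le => // i; rewrite 4!mxE.
have /andP[] := floor_itv (z 0 i); move: (z 0 i : R) (Num.floor _) => a n.
rewrite intrD rmorphB /=; have [|_] := eqVneq i i0; last first.
  by rewrite ler_norml => h1 h2; apply/andP; split; lra.
have : 0 <= (n %% 2)%Z <= 1 by lia.
move: (n %% 2)%Z => m; rewrite -!(ler_int R) => /andP[m0 m1] _ h1 h2.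
by rewrite ler_norml; apply/andP; split; lra.
Qed.

End EuclideanNet.

(** At distances [l >= 1] the factor [ln (rho / l)] is at most [ln rho], so the modulus becomes a
    Lipschitz bound whose constant depends only on the radius. *)
Lemma homogeneous_lipschitz (R : realType) (d : nat) (b alpha : R) (w : R -> R)
    (X : set 'rV[R]_d) (f : 'rV[R]_d -> 'rV[R]_d) (a0 : R) :
    0 <= alpha -> 0 < a0 <= b ->
    (forall t, 0 < t < a0 -> w t = t * powR (ln t^-1) alpha) ->
    homogeneous_mapping b w X f ->
  exists K eta : R, [/\ 0 < K, 0 < eta < 1 &
    forall rho x1 x2, X x1 -> X x2 -> enorm x1 < rho -> enorm x2 < rho ->
      1 <= enorm (x2 - x1) < eta * rho ->
      enorm (f x2 - f x1) <= K * powR (ln rho) alpha * enorm (x2 - x1)].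
Proof.
move=> alpha0 /andP[a00 a0b] wE [K [a [K0 /andP[a1 a2] Kf]]].
exists K, (Num.min a a0); split=> //.
  by rewrite lt_min a1 a00 /= gt_min a2.
move=> rho x1 x2 X1 X2 n1 n2 /andP[l1 l2].
set l := enorm _ in l1 l2 *.
have l0 : 0 < l by exact: lt_le_trans l1.
have eta0 : 0 < Num.min a a0 by rewrite lt_min a1 a00.
have rho0 : 0 < rho by rewrite -(pmulr_rgt0 _ eta0) (lt_trans l0).
have la : l < a * rho by apply: lt_le_trans l2 _; rewrite ler_pM2r // ge_min lexx.
have la0 : l / rho < a0.
  by rewrite ltr_pdivrMr //; apply: lt_le_trans l2 _; rewrite ler_pM2r // ge_min lexx orbT.
have x12 : x1 != x2.
  apply/eqP => x12; move: l0; rewrite /l x12 subrr /enorm big1 ?sqrtr0 ?ltxx // => i _.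
  by rewrite mxE expr0n.
have := Kf rho x1 x2 rho0 X1 X2 x12 n1 n2 la (lt_le_trans la0 a0b).
move/le_trans; apply; rewrite wE ?divr_gt0 // -/l.
have -> : K * rho * (l / rho * powR (ln (l / rho)^-1) alpha)
    = K * powR (ln (rho / l)) alpha * l.
  by rewrite invf_div; field; rewrite gt_eqF.
rewrite ler_pM2r // ler_pM2l // ge0_ler_powR //.
- rewrite nnegrE ln_ge0 // ler_pdivlMr // mul1r.
  by rewrite (le_trans (ltW la)) // ler_piMl ?ltW.
- by rewrite nnegrE ln_ge0 // (le_trans l1) // (le_trans (ltW la)) // ler_piMl ?ltW.
- by rewrite ler_ln ?posrE ?divr_gt0 // ler_pdivrMr // ler_peMr // ltW.
Qed.

(** Replacing Euclidean by sup distances costs the factor [d]. The bound on [M] keeps the box inside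
    the ball of radius [rho] and its differences below [eta * rho]. *)
Lemma lattice_lipschitz (R : realType) (d : nat) (X : set 'rV[R]_d)
    (S : 'rV[int]_d -> Prop) (f : 'rV[R]_d -> 'rV[R]_d) (h : 'rV[int]_d -> 'rV[int]_d)
    (c eta rho : R) (L : nat) (M : int) :
    (forall x, S x -> X (to_real R x)) ->
    (forall x, S x -> f (to_real R x) = to_real R (h x)) ->
    (forall x1 x2, X x1 -> X x2 -> enorm x1 < rho -> enorm x2 < rho ->
      1 <= enorm (x2 - x1) < eta * rho -> enorm (f x2 - f x1) <= c * enorm (x2 - x1)) ->
    0 <= c -> c * d%:R <= L%:R -> 0 < rho -> eta < 1 -> 2 * d%:R * M%:~R < eta * rho ->
  forall r x y, S x -> S y -> close M 0 x -> close M 0 y -> close r x y ->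
    close (L%:Z * r) (h x) (h y).
Proof.
move=> SX fh f_lip c0 cL rho0 eta1 Mrho r x y Sx Sy xM yM xy i.
have r0 : 0 <= r by apply: le_trans (xy i).
have M0 : 0 <= M by apply: le_trans (xM i).
have [->|xNy] := eqVneq x y; first by rewrite subrr normr0 mulr_ge0.
have dM0 : 0 <= d%:R * M%:~R :> R by rewrite mulr_ge0 // ler0z.
have dM : d%:R * M%:~R < rho.
  have : eta * rho < rho by rewrite gtr_pMl.
  by move: Mrho dM0; rewrite -mulrA; move: (d%:R * _) => u; lra.
have small (z : 'rV[int]_d) : close M 0 z -> enorm (to_real R z) < rho.
  move=> zM; apply: le_lt_trans dM; apply: (@enorm_le R d _ M%:~R) => [|j].
    by rewrite ler0z.
  rewrite to_realE -intr_norm ler_int; have := zM j.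
  by rewrite mxE sub0r normrN.
have lip := f_lip _ _ (SX _ Sy) (SX _ Sx) (small _ yM) (small _ xM).
have xyM : close (2 * M) x y.
  by move=> j; have := xM j; have := yM j; rewrite !mxE;
    move: (x 0 j : int) (y 0 j : int); clear; lia.
have l1 := enorm_to_real_ge1 R (_ : y != x); rewrite eq_sym xNy in l1.
have /lip : 1 <= enorm (to_real R x - to_real R y) < eta * rho.
  rewrite l1 //=; apply: le_lt_trans Mrho.
  apply: le_trans (enorm_to_real_le R _ xyM) _; first by rewrite mulr_ge0.
  by rewrite intrM mulrA [_ * 2]mulrC.
rewrite !fh // => hxy; rewrite -(ler_int R) intr_norm intrB -!to_realE.
have -> : to_real R (h x) 0 i - to_real R (h y) 0 i
    = (to_real R (h x) - to_real R (h y)) 0 i.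
  by rewrite !mxE.
apply: le_trans (ler_coord_enorm _ _) _; apply: le_trans hxy _.
apply: (@le_trans _ _ (c * (d%:R * r%:~R))).
  by rewrite ler_wpM2l // enorm_to_real_le.
by rewrite mulrA intrM ler_wpM2r // ler0z.
Qed.

(** The Lipschitz constant depends on the radius, which itself depends on [L]. With [J = 2 c L ^ 8]
    the logarithm of the radius is at most [B L ^ 16], whose 32nd root grows only like the square
    root of [L]; any [L > B k ^ 32] breaks the circle. *)
Lemma exists_lipschitz_scale (R : realType) (c : nat) (C k : R) :
    1 <= C -> 0 < k ->
  exists2 L : nat, (0 < L)%N & forall J, J = (c * L ^ 8 + c * L ^ 8)%N ->
    k * powR (ln (C * L%:R * (width J)%:R)) 32^-1 <= L%:R.
Proof.
move=> C1 k0; have C0 : 0 < C by exact: lt_le_trans C1.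
pose B : R := C + 1 + (2 * c + 3)%:R ^+ 2.
have B0 : 0 < B by rewrite !addr_gt0 // exprn_gt0 // ltr0n addnS.
pose L := Num.bound (B * k ^+ 32).
have BkL : B * k ^+ 32 < L%:R by apply: archi_boundP; rewrite mulr_ge0 ?exprn_ge0 // ltW.
have L0 : (0 < L)%N.
  by rewrite -(ltr0n R); apply: le_lt_trans BkL; rewrite mulr_ge0 ?exprn_ge0 // ltW.
exists L => // J JE.
have L1 : 1 <= L%:R :> R by rewrite ler1n.
have LR0 : 0 < L%:R :> R by rewrite ltr0n.
have wJ0 : 0 < (width J)%:R :> R by rewrite ltr0n width_gt0.
have lnw : ln ((width J)%:R : R) <= ((J + 3) ^ 2)%:R.
  rewrite /width natrX lnXn // -[leRHS]mul1r mulr_natr lerMn2r.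
  apply/orP; right; have := le_ln1Dx (_ : -1 < 1 :> R).
  by rewrite -[1 + 1]/2 => -> //; lra.
have L16 : 1 <= L%:R ^+ 16 :> R by rewrite exprn_ege1.
have lnB : ln (C * L%:R * (width J)%:R) <= B * L%:R ^+ 16.
  rewrite !lnM ?posrE ?mulr_gt0 //.
  have lnC : ln C <= C * L%:R ^+ 16.
    by apply: le_trans (ltW (ln_sublinear C0)) _; rewrite ler_peMr // ltW.
  have lnL : ln (L%:R : R) <= 1 * L%:R ^+ 16.
    by apply: le_trans (ltW (ln_sublinear LR0)) _; rewrite mul1r ler_eXnr.
  rewrite /B 2!mulrDl lerD //; first exact: lerD.
  apply: le_trans lnw _; rewrite -natrX -[L%:R ^+ 16]natrX -natrM ler_nat.
  rewrite -[(L ^ 16)%N]/(L ^ (8 * 2))%N expnM -expnMn leq_exp2r // JE.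
  have : (0 < L ^ 8)%N by rewrite expn_gt0 L0.
  by move: (L ^ 8)%N; clear => P; nia.
have ln0 : 0 <= ln (C * L%:R * (width J)%:R).
  by rewrite ln_ge0 // !mulr_ege1 // ler1n width_gt0.
have leLk : ln (C * L%:R * (width J)%:R) <= (L%:R / k) ^+ 32.
  apply: le_trans lnB _; rewrite expr_div_n ler_pdivlMr ?exprn_gt0 //.
  rewrite mulrAC -[leRHS]/(L%:R ^+ (16 + 16)) [leRHS]exprD ler_wpM2r ?exprn_ge0 //.
  by apply: le_trans (ltW BkL) _; rewrite ler_eXnr.
have Lk0 : 0 <= L%:R / k by rewrite divr_ge0 // ltW.
rewrite mulrC -ler_pdivlMr //.
have -> : L%:R / k = powR ((L%:R / k) ^+ 32) 32^-1.
  by rewrite -powR_mulrn // -powRrM divff ?powRr1 // pnatr_eq0.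
by rewrite ge0_ler_powR ?nnegrE ?invr_ge0 ?exprn_ge0.
Qed.

(** * Transfer of the bijection to integer vectors *)

Section LatticeMap.

Variables (R : realType) (d : nat) (i0 i1 : 'I_d).
Variables f g : 'rV[R]_d -> 'rV[R]_d.
Hypothesis f_bij : set_bij (@real_net R d i0 i1) (@integer_lattice R d) f.
Hypothesis fK : {in @real_net R d i0 i1, cancel f g}.

(** Where [h] takes lattice values, the floor merely undoes the embedding [to_real]. *)
Definition floor_map (h : 'rV[R]_d -> 'rV[R]_d) (x : 'rV[int]_d) : 'rV[int]_d :=
  \row_i Num.floor (h (to_real R x) 0 i).

Lemma to_real_lattice (x : 'rV[int]_d) : @integer_lattice R d (to_real R x).
Proof. by move=> i; rewrite to_realE intr_int. Qed.

Lemma floor_map_to_real (h : 'rV[R]_d -> 'rV[R]_d) (x y : 'rV[int]_d) :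
  h (to_real R x) = to_real R y -> floor_map h x = y.
Proof. by move=> hx; apply/rowP => i; rewrite mxE hx to_realE intrKfloor. Qed.

Lemma lattice_to_real (z : 'rV[R]_d) : @integer_lattice R d z ->
  exists x, z = to_real R x.
Proof.
move=> zi; exists (\row_i Num.floor (z 0 i)); apply/rowP => i.
by rewrite to_realE mxE floorK.
Qed.

Lemma net_mapE (x : 'rV[int]_d) : int_net i0 i1 x ->
  f (to_real R x) = to_real R (floor_map f x).
Proof.
move=> xnet; have [fXY _ _] := f_bij.
have [|y fy] := @lattice_to_real (f (to_real R x)); first by apply: fXY; exists x.
by rewrite (floor_map_to_real fy).
Qed.

Lemma net_map_inv (y : 'rV[int]_d) : exists2 x,
  int_net i0 i1 x & g (to_real R y) = to_real R x /\ f (to_real R x) = to_real R y.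
Proof.
have [_ _ /(_ _ (to_real_lattice y)) [_ [x xnet <-] fx]] := f_bij.
by exists x => //; split=> //; rewrite -fx fK // inE; exists x.
Qed.

End LatticeMap.

(** * Choice of the parameters and conclusion *)

Lemma scale_arith (d L K J0 : nat) : (0 < d)%N -> (0 < L)%N ->
    K = (1024 * (1024 * (d ^ 3 * L ^ 4)))%N ->
    J0 = (4 * d * (1024 * (1024 * d ^ 3)) * L ^ 8)%N ->
  [/\ (4 * K <= 2 ^ J0)%N, (64 * d * (L ^ 2 + L + 2) <= width J0)%N
    & (d * L ^ 4 * K <= J0)%N].
Proof.
move=> d0 L0 KE JE.
have JK : J0 = (4 * (d * L ^ 4 * K))%N by rewrite KE JE; ring.
have dL0 : (0 < d * L ^ 4)%N by rewrite muln_gt0 expn_gt0 d0 L0.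
have K4 : (4 * K <= J0)%N by rewrite JK leq_mul2l leq_pmull.
have ltJ : (4 * K <= 2 ^ J0)%N by rewrite (leq_trans K4) // ltnW // ltn_expl.
split=> //; last by rewrite JK leq_pmull.
have le_width : (2 ^ J0 <= width J0)%N.
  rewrite leq_pexp2l // -mulnn; apply: leq_trans (leq_addr 3 _) _.
  by rewrite leq_pmulr ?addn3.
apply: (leq_trans _ (leq_trans ltJ le_width)).
have d3 : (d <= d ^ 3)%N by rewrite -{1}[d]expn1 leq_pexp2l.
have L4 : (L ^ 2 + L + 2 <= 4 * L ^ 4)%N.
  have l2 : (L ^ 2 <= L ^ 4)%N by rewrite leq_pexp2l.
  have l1 : (L <= L ^ 4)%N by rewrite -{1}[L]expn1 leq_pexp2l.
  have l0 : (0 < L ^ 4)%N by rewrite expn_gt0 L0.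
  by move: (L ^ 4)%N (L ^ 2)%N l0 l1 l2 => P Q; clear; lia.
rewrite KE; have := leq_mul d3 L4; clear.
by rewrite mulnCA -mulnA; move: (_ * _ ^ 4)%N (d * _)%N => x y; lia.
Qed.

Theorem theorem1p2 (R : realType) (d : nat) (hd : (2 <= d)%N) :
  exists (alpha0 : R) (X : set 'rV[R]_d),
    [/\ 0 < alpha0, separated_net X &
        forall (b : R) (w : R -> R), modulus_of_continuity b w ->
          (exists a : R, 0 < a <= b /\
             forall t : R, 0 < t < a -> w t = t * powR (ln (t^-1)) alpha0) ->
          irregular b w X].
Proof.
pose i0 := Ordinal (ltnW hd); pose i1 := Ordinal hd.
have i01 : i0 != i1 by [].
have d0 : (0 < d)%N := ltnW hd.
exists 32^-1, (@real_net R d i0 i1); split=> [||b w _ [a0 [a0b wE]] [f [g [fbij fK fh gh]]]].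
- by rewrite invr_gt0.
- exact: real_net_separated.
have alpha0 : 0 <= 32^-1 :> R by rewrite invr_ge0.
have [Kf [ef [Kf0 /andP[ef0 ef1] fl]]] := homogeneous_lipschitz alpha0 a0b wE fh.
have [Kg [eg [Kg0 /andP[eg0 eg1] gl]]] := homogeneous_lipschitz alpha0 a0b wE gh.
pose fz := floor_map f; pose gz := floor_map g.
have fE := net_mapE fbij; have gP := net_map_inv fbij fK.
have gE y : g (to_real R y) = to_real R (gz y).
  by have [x _ [gy _]] := gP y; rewrite /gz (floor_map_to_real gy).
have fgK x : int_net i0 i1 x -> gz (fz x) = x.
  move=> xnet; apply: (@to_real_inj R); rewrite -gE -fE // fK // inE.
  by exists x.
have gz_net y : int_net i0 i1 (gz y).
  by have [x xnet [gy _]] := gP y; rewrite /gz (floor_map_to_real gy).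
have gfK y : fz (gz y) = y.
  have [x xnet [gy fx]] := gP y.
  by rewrite /gz (floor_map_to_real gy) /fz (floor_map_to_real fx).
(* The balls are centred at the origin but the box for [g] at [f 0]; [m] bounds the displacement. *)
pose m := (\sum_i `|fz 0%R 0%R i|)%N.
have fm i : `|fz 0 0 i| <= m%:Z.
  by rewrite -abszE lez_nat /m (bigD1 i) //= leq_addr.
pose eta := Num.min ef eg.
have eta0 : 0 < eta by rewrite lt_min ef0.
(* Chosen so that [rho = C * L * width J] satisfies [2 d M < eta rho]: the box radius [M] below is
   at most [(m + 8) * L * width J]. *)
pose C : R := 2 * d%:R * (m + 9)%:R / eta + 1.
have C1 : 1 <= C by rewrite lerDr divr_ge0 // ?ltW // mulr_ge0.
(* The sum [Kf + Kg] lets one [L] serve both maps; [d] is the factor from [lattice_lipschitz]. *)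
have k0 : 0 < (Kf + Kg) * d%:R by rewrite mulr_gt0 ?addr_gt0 // ltr0n.
pose c := (4 * d * (1024 * (1024 * d ^ 3)))%N.
have [L L0 /(_ _ erefl)] := exists_lipschitz_scale c C1 k0.
set J0 := (c * L ^ 8)%N; set J := (J0 + J0)%N; set rho := C * _ * _ => leL.
pose K := (1024 * (1024 * (d ^ 3 * L ^ 4)))%N.
(* The box of radius [M] about 0 contains the boxes required for [f] and for [g]. *)
pose M : int := m%:Z + 8 * L%:Z * (width J)%:Z.
have Lw0 : 0 < (L * width J)%:R :> R by rewrite ltr0n muln_gt0 L0 width_gt0.
have Mrho : 2 * d%:R * M%:~R < eta * rho.
  have -> : eta * rho = (2 * d%:R * (m + 9)%:R + eta) * (L * width J)%:R.
    by rewrite /rho /C natrM; field; rewrite gt_eqF.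
  set X : R := (L * width J)%:R in Lw0 *.
  have X1 : 1 <= X by rewrite ler1n -(ltr0n R).
  have ME : M%:~R = m%:R + 8 * X :> R.
    by rewrite /M intrD !intrM -mulrA -intrM -PoszM.
  apply: (@le_lt_trans _ _ (2 * d%:R * (m + 9)%:R * X)); last first.
    by rewrite ltr_pM2r ?ltrDl.
  rewrite -!mulrA !ler_pM2l ?ltr0n // ME natrD.
  have : 0 <= m%:R * (X - 1) by rewrite mulr_ge0 // subr_ge0.
  by rewrite mulrBr mulr1 (mulrDl m%:R); move: (m%:R * X) => mX; lra.
have rho0 : 0 < rho by rewrite /rho -mulrA -natrM mulr_gt0 // (lt_le_trans ltr01).
set p := powR _ _ in leL.
have p0 : 0 <= p := powR_ge0 _ _.
have [KJ vL LJ] := scale_arith d0 L0 (erefl K) (erefl J0).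
have K0 : (0 < K)%N by rewrite !muln_gt0 ?expn_gt0 d0 L0.
have le_L (k : R) : 0 <= k <= Kf + Kg -> 0 <= k * p /\ k * p * d%:R <= L%:R.
  move=> /andP[k00 kK]; split; first by rewrite mulr_ge0.
  by apply: le_trans leL; rewrite mulrAC !ler_wpM2r.
have MleJ : 4 * (width J)%:Z <= M.
  rewrite /M -mulrA; have : (width J)%:Z <= L%:Z * (width J)%:Z by rewrite -PoszM lez_nat leq_pmull.
  by move: (width J) (_ * (width J)%:Z) => u v; clear; lia.
apply: (@no_bilipschitz_bijection d i0 i1 i01 fz gz L J K L0 K0 fgK gfK gz_net _ _ J0) => //.
- move=> r x y xnet ynet xJ yJ.
  have [|c0 cL] := le_L Kf; first by rewrite ltW // lerDl ltW.
  apply: (lattice_lipschitz (X := @real_net R d i0 i1) _ fE (fl rho) c0 cL rho0 ef1 (M := M)) => //.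
  - by move=> z znet; exists z.
  - by apply: lt_le_trans Mrho _; rewrite ler_wpM2r ?ge_min ?lexx // ltW.
  - exact: close_le xJ.
  - exact: close_le yJ.
- move=> r x y xJ yJ.
  have [|c0 cL] := le_L Kg; first by rewrite ltW // lerDr ltW.
  have box z : close (8 * L%:Z * (width J)%:Z) (fz 0) z -> close M 0 z.
    move=> zJ; have f0 : close m%:Z 0 (fz 0).
      by move=> i; rewrite mxE sub0r normrN.
    exact: close_trans f0 zJ.
  apply: (lattice_lipschitz (S := fun=> True) (X := @integer_lattice R d) _ _
    (gl rho) c0 cL rho0 eg1 (M := M)) => //.
  - by move=> z _; exact: to_real_lattice.
  - by apply: lt_le_trans Mrho _; rewrite ler_wpM2r ?ge_min ?lexx ?orbT // ltW.
  - exact: box.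
  - exact: box.
Qed.
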